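(* Let $n\ge1$ and let $p:\mathbb{R}^n\to[1,+\infty)$ be a measurable function with $1=p^-\le p^+<+\infty$. Let $u\in L^{p(\cdot)}(\mathbb{R}^n)$ and set $E=\{x\in\mathbb{R}^n: p(x)=1\}$. Assume that $\operatorname{int}(E)\neq\emptyset$ and $$\sup_{0<\delta<1}\iint_{\{(x,y)\in\mathbb{R}^n\times\mathbb{R}^n:\ |u(x)-u(y)|>\delta\}} \frac{\delta^{p(x)}}{|x-y|^{n+p(x)}}\,dx\,dy<+\infty.$$ Then $$\sup_{B\subset\operatorname{int}(E)}|B|^{-\frac{n+1}{n}}\int_B\int_B|u(x)-u(y)|\,dx\,dy<+\infty,$$ where the supremum is over all balls $B\subset\operatorname{int}(E)$. In particular, for $n=1$, $$\sup_{B\subset\operatorname{int}(E)}\frac{1}{|B|^2}\int_B\int_B|u(x)-u(y)|\,dx\,dy<+\infty,$$ that is, $u\in BMO(E)$.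
   Context: For a measurable $p:\mathbb{R}^n\to[1,+\infty)$: $p^-:=\operatorname{ess\,inf}_{\mathbb{R}^n}p$ and $p^+:=\operatorname{ess\,sup}_{\mathbb{R}^n}p$. $L^{p(\cdot)}(\mathbb{R}^n)$ is the space of measurable $u:\mathbb{R}^n\to\mathbb{R}$ with $\int_{\mathbb{R}^n}|u(x)|^{p(x)}\,dx<+\infty$. $|B|$ denotes the Lebesgue measure of $B$ and $\operatorname{int}(E)$ the topological interior of $E$. Here $u\in BMO(E)$ (bounded mean oscillation on $E$) means precisely that the last displayed supremum, over balls $B\subset\operatorname{int}(E)$, is finite. *)

(* Defs.v *)
From HB Require Import structures.
From mathcomp Require Import all_boot all_order all_algebra.
From mathcomp Require Import all_classical all_reals all_analysis ess_sup_inf.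
Set Implicit Arguments.
Unset Strict Implicit.
Unset Printing Implicit Defensive.
Import Order.TTheory GRing.Theory Num.Theory.
Import numFieldNormedType.Exports.
Local Open Scope classical_set_scope.
Local Open Scope ring_scope.

(** The coordinate maps generate the Borel sigma-algebra of R^n; this mirrors
    the library instance on [n.-tuple R], on a carrier that has a topology. *)
Section borel_rV.
Context (R : realType) (n : nat).

Let coord (i : 'I_n) (x : 'rV[R]_n) : R := x ord0 i.

Let rV_set0 : g_sigma_preimage coord set0.
Proof. exact: sigma_algebra0. Qed.

Let rV_setC A : g_sigma_preimage coord A -> g_sigma_preimage coord (~` A).
Proof. exact: sigma_algebraC. Qed.

Let rV_bigcup (F : _^nat) : (forall i, g_sigma_preimage coord (F i)) ->
  g_sigma_preimage coord (\bigcup_i (F i)).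
Proof. exact: sigma_algebra_bigcup. Qed.

HB.instance Definition _ := @isMeasurable.Build default_measure_display
  'rV[R]_n (g_sigma_preimage coord) rV_set0 rV_setC rV_bigcup.

Lemma measurable_coord (i : 'I_n) :
  measurable_fun [set: 'rV[R]_n] (fun x => x ord0 i).
Proof.
move=> _ Y mY; rewrite setTI; apply: sub_sigma_algebra => /=.
rewrite -bigcup_seq/=; exists i => /=; first by rewrite mem_index_enum.
by exists Y => //; rewrite setTI.
Qed.

Lemma measurable_fun_rV d (T : measurableType d) (f : T -> 'rV[R]_n) :
  (forall i, measurable_fun [set: T] (fun x => f x ord0 i)) ->
  measurable_fun [set: T] f.
Proof.
move=> mf _ Y mY; rewrite setTI.
pose S := [set A : set 'rV[R]_n | measurable (f @^-1` A)].
suff : g_sigma_preimage coord `<=` S by apply.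
apply: smallest_sub.
- split; rewrite /S/=.
  + by rewrite preimage_set0.
  + by move=> A mA; rewrite setTD -preimage_setC; exact: measurableC.
  + by move=> F mF; rewrite preimage_bigcup; exact: bigcupT_measurable.
- rewrite -bigcup_seq => A [i _ [B mB <-]]; rewrite /S/= setTI.
  by have := mf i measurableT B mB; rewrite setTI.
Qed.

End borel_rV.

Section lebesgue_rV.
Context (R : realType).

Definition rV_cons n (z : R * 'rV[R]_n) : 'rV[R]_n.+1 :=
  row_mx (z.1%:M : 'rV[R]_1) z.2.

Lemma measurable_rV_cons n : measurable_fun setT (@rV_cons n).
Proof.
apply: measurable_fun_rV => i; case: (@splitP 1 n i) => j ij.
- have -> : i = lshift n j by exact: val_inj.
  rewrite (_ : (fun _ => _) = fst) //.
  apply/funext => z; rewrite /rV_cons.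
  by rewrite [LHS](@row_mxEl R 1 1 n z.1%:M z.2 ord0 j) !ord1 mxE eqxx.
- have -> : i = rshift 1 j by exact: val_inj.
  rewrite (_ : (fun _ => _) = (fun x : 'rV[R]_n => x ord0 j) \o snd).
    by apply: measurableT_comp => //; exact: measurable_coord.
  by apply/funext => z; exact: (@row_mxEr R 1 1 n z.1%:M z.2 ord0 j).
Qed.

(** n-fold product of the one-dimensional Lebesgue measure, on Borel sets *)
Fixpoint borel_lebesgue n : set 'rV[R]_n -> \bar R :=
  match n with
  | 0 => \d_(0 : 'rV[R]_0)
  | m.+1 => pushforward (lebesgue_measure \x borel_lebesgue (n := m))%E
              (@rV_cons m)
  end.

Let sfm n := {sigma_finite_measure set 'rV[R]_n -> \bar R}.

Section step.
Local Open Scope ereal_scope.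
Variables (n : nat) (m : sfm n).

Definition rV_step : set 'rV[R]_n.+1 -> \bar R :=
  pushforward (@lebesgue_measure R \x m) (@rV_cons n).

Let step0 : rV_step set0 = 0.
Proof. by rewrite /rV_step /pushforward preimage_set0 measure0. Qed.

Let step_ge0 A : 0 <= rV_step A.
Proof. exact: (measure_ge0 (lebesgue_measure \x m)). Qed.

Let mpre A : measurable A -> measurable (@rV_cons n @^-1` A).
Proof. by move=> mA; rewrite -[X in measurable X]setTI; exact: measurable_rV_cons. Qed.

Let step_sigma_additive : semi_sigma_additive rV_step.
Proof.
move=> F mF tF mUF; rewrite /rV_step /pushforward preimage_bigcup.
apply: measure_semi_sigma_additive.
- by move=> i; exact: mpre.
- apply/trivIsetP => /= i j _ _ ij; rewrite -preimage_setI.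
  by move/trivIsetP : tF => /(_ _ _ _ _ ij) ->//; rewrite preimage_set0.
- by rewrite -preimage_bigcup; exact: mpre.
Qed.

HB.instance Definition _ := isMeasure.Build _ _ _ rV_step
  step0 step_ge0 step_sigma_additive.

Let head_tail (x : 'rV[R]_n.+1) : R * 'rV[R]_n :=
  (x ord0 ord0, \row_j x ord0 (lift ord0 j)).

Let measurable_head_tail : measurable_fun setT head_tail.
Proof.
apply/measurable_fun_pairP; split; first exact: measurable_coord.
apply: measurable_fun_rV => i.
rewrite (_ : (fun _ => _) = fun x : 'rV[R]_n.+1 => x ord0 (lift ord0 i)).
  exact: measurable_coord.
by apply/funext => x /=; rewrite mxE.
Qed.

Let rV_consK : cancel (@rV_cons n) head_tail.
Proof.
move=> [a v]; congr pair => /=.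
  have -> : @ord0 n = lshift n (@ord0 0) by exact: val_inj.
  by rewrite [LHS](@row_mxEl R 1 1 n) mxE.
apply/rowP => j; rewrite mxE.
have -> : lift (@ord0 n) j = rshift 1 j by exact: val_inj.
exact: (@row_mxEr R 1 1 n).
Qed.

Let step_sigma_finite : sigma_finite setT rV_step.
Proof.
have /sigma_finiteP[F [TF ndF Foo]] := sigma_finiteT (@lebesgue_measure R).
have /sigma_finiteP[G [TG ndG Goo]] := sigma_finiteT m.
exists (fun i => head_tail @^-1` (F i `*` G i)).
  rewrite -preimage_bigcup -[LHS](@preimage_setT _ _ head_tail).
  congr (_ @^-1` _); rewrite -setXTT TF TG predeqE => -[x y]; split.
    move=> [/= [i _ Fix] [k _ Gky]]; exists (maxn i k) => //; split.
    - by move: x Fix; exact/subsetPset/ndF/leq_maxl.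
    - by move: y Gky; exact/subsetPset/ndG/leq_maxr.
  by move=> [i _ []/= ? ?]; split; exists i.
move=> k; have [mF Fk] := Foo k; have [mG Gk] := Goo k; split.
  rewrite -[X in measurable X]setTI.
  by apply: measurable_head_tail => //; exact: measurableX.
rewrite /rV_step /pushforward -comp_preimage.
rewrite (_ : _ \o _ = id) ?preimage_id; last exact/funext.
by rewrite product_measure1E// lte_mul_pinfty// ge0_fin_numE.
Qed.

HB.instance Definition _ := Measure_isSigmaFinite.Build _ _ _ rV_step
  step_sigma_finite.

End step.

Lemma borel_lebesgue_sfm n : exists m : sfm n, borel_lebesgue (n := n) = m.
Proof.
elim: n => [|n [m mE]]; first by exists (\d_(0 : 'rV[R]_0)).
by exists (rV_step m) => /=; rewrite mE.
Qed.

Let borel_lebesgue0 n : borel_lebesgue (n := n) set0 = 0%E.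
Proof. by have [m ->] := borel_lebesgue_sfm n. Qed.

Let borel_lebesgue_ge0 n A : (0 <= borel_lebesgue (n := n) A)%E.
Proof. by have [m ->] := borel_lebesgue_sfm n. Qed.

Let borel_lebesgue_sigma_additive n :
  semi_sigma_additive (borel_lebesgue (n := n)).
Proof.
by have [m ->] := borel_lebesgue_sfm n; exact: measure_semi_sigma_additive.
Qed.

HB.instance Definition _ n := isMeasure.Build _ _ _ (@borel_lebesgue n)
  (@borel_lebesgue0 n) (@borel_lebesgue_ge0 n)
  (@borel_lebesgue_sigma_additive n).

Let borel_lebesgue_sigma_finite n : sigma_finite setT (@borel_lebesgue n).
Proof. by have [m ->] := borel_lebesgue_sfm n; exact: sigma_finiteT. Qed.

HB.instance Definition _ n := Measure_isSigmaFinite.Build _ _ _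
  (@borel_lebesgue n) (@borel_lebesgue_sigma_finite n).

(** Completion of [borel_lebesgue]: its domain is the sigma-algebra of all
    Lebesgue-measurable sets, not only the Borel ones. *)
Definition lebesgueRn n := @completed_measure_extension _ _ _ (@borel_lebesgue n).

HB.instance Definition _ n := Measure.on (@lebesgueRn n).

Let lebesgueRn_sigma_finite n : sigma_finite setT (@lebesgueRn n).
Proof. exact/completed_measure_extension_sigma_finite/sigma_finiteT. Qed.

HB.instance Definition _ n := Measure_isSigmaFinite.Build _ _ _
  (@lebesgueRn n) (@lebesgueRn_sigma_finite n).

End lebesgue_rV.
Arguments lebesgueRn {R n}.

(** R^n with the Lebesgue sigma-algebra (convertible to ['rV[R]_n]) *)
Definition Rn (R : realType) (n : nat) : measurableType _ :=
  caratheodory_type (@borel_lebesgue R n)^*%mu.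

Section bmo.
Context (R : realType) (n : nat).
Implicit Types (x y : 'rV[R]_n) (B E : set 'rV[R]_n) (p u : Rn R n -> R).

(** The library norm on ['rV[R]_n] is the max norm, whose topology is that of
    the Euclidean norm. *)
Definition enorm x : R := Num.sqrt (\sum_i x ord0 i ^+ 2).

Definition edist x y : R := enorm (x - y).

(** Open and closed balls give the same suprema below: spheres are null, and a
    closed ball contained in an open set contains its open ball. *)
Definition is_eball B :=
  exists x r, 0 < r /\ B = [set y | edist x y < r].

Definition variable_Lp p u :=
  measurable_fun setT u /\
  (\int[lebesgueRn]_x (`|u x| `^ p x)%R%:E < +oo)%E.

(** For [0 <= delta] the domain avoids the diagonal, where the quotient is
    degenerate. *)
Definition truncated_energy p u (delta : R) : \bar R :=
  (\int[lebesgueRn \x lebesgueRn]_(z in [set z | (delta < `|u z.1 - u z.2|)%R])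
     (delta `^ p z.1 / edist z.1 z.2 `^ (n%:R + p z.1))%R%:E)%E.

Definition double_oscillation u B : \bar R :=
  (\int[lebesgueRn]_(x in B) \int[lebesgueRn]_(y in B) `|u x - u y|%R%:E)%E.

Definition ball_inside E : set (set 'rV[R]_n) :=
  [set B | is_eball B /\ B `<=` E].

Definition BMO E u : Prop :=
  (ereal_sup [set ((fine (lebesgueRn B) ^+ 2)^-1)%R%:E * double_oscillation u B
             | B in ball_inside (interior E)] < +oo)%E.

End bmo.

(* Main.v *)
Require Import Defs.
From mathcomp Require Import all_boot all_order all_algebra.
From mathcomp Require Import all_classical all_reals all_analysis ess_sup_inf.
From mathcomp Require Import measurable_realfun ring lra.
Set Implicit Arguments.
Unset Strict Implicit.
Unset Printing Implicit Defensive.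
Import Order.TTheory GRing.Theory Num.Theory.
Import numFieldNormedType.Exports.
Local Open Scope classical_set_scope.
Local Open Scope ring_scope.

(** On a ball [B] of radius [r] inside [int E] the exponent is [1], so the
    hypothesis bounds, by one constant [M], the energies
    [int_(B x B, |u x - u y| > delta) delta / |x - y|^(n+1)] for all [delta < 1].
    Write [phi_c t = max 0 (min t T - c)]. Summing over [delta = 2^-1, ..., 2^-J]
    bounds the integral of [phi_(2^-J) |u x - u y| / |x - y|^(n+1)] by
    [(J + 2 T) M], where only the leading term in [J] matters: the cap [T] costs a
    bounded amount. Conversely [phi_(2 c) (s + t) <= phi_c s + phi_c t], so
    inserting the midpoint of [x] and [y] and changing variables gives
    [int_(|x - y| < l) phi_(2 c) <= 2^(n+1) int_(|x - y| < l / 2) phi_c]. Iterating,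
    each of the [K] dyadic scales [l = 2 r, r, r / 2, ...] contributes at least
    [int_(B x B) phi_(2^-s)] (with [J = s + K]) to that energy, up to the factor
    [2 (2 r)^(n+1)]. Hence [K int_(B x B) phi_(2^-s) <= 2 (2 r)^(n+1) (s + K + 2 T) M];
    divide by [K], let [K], then [s] and [T], tend to infinity.

    The function [u] is only Lebesgue measurable, and linear changes of variables
    do not preserve the product of two completed sigma-algebras; [u] is therefore
    first replaced by a Borel function equal to it almost everywhere. *)

(** * Borel representatives of Lebesgue-measurable functions *)

Section completion.
Local Open Scope ereal_scope.
Context d (T : measurableType d) (R : realType).
Variable mu : {sigma_finite_measure set T -> \bar R}.

Let cT : measurableType _ := caratheodory_type (mu^*)%mu.

Lemma measurable_caratheodory (A : set T) :
  measurable A -> measurable (A : set cT).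
Proof. exact: caratheodory_measurable_mu_ext. Qed.

Lemma measurable_id_caratheodory : measurable_fun setT (id : cT -> T).
Proof. by move=> _ A mA; rewrite setTI; exact: measurable_caratheodory. Qed.

(** For each [k] a countable measurable cover comes within [1 / (k + 1)] of the outer measure; the
    intersection over [k] of the unions of these covers attains it. *)
Lemma mu_ext_measurable_hull (X : set T) : (mu^*)%mu X < +oo ->
  exists G, [/\ measurable G, X `<=` G & mu G = (mu^*)%mu X].
Proof.
move=> Xoo.
have cover k : exists F : (set T)^nat, measurable_cover X F /\
   \sum_(0 <= i <oo) mu (F i) < (mu^*)%mu X + k.+1%:R^-1%:E.
  have Xfin : (mu^*)%mu X \is a fin_num.
    by rewrite ge0_fin_numE// mu_ext_ge0.
  have k0 : (0 < k.+1%:R^-1 :> R)%R by rewrite invr_gt0.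
  by have [_/= [F XF <-] ?] := lb_ereal_inf_adherent k0 Xfin; exists F.
pose F k := projT1 (cid (cover k)).
have XF k : measurable_cover X (F k) by rewrite /F; case: cid => ? [].
have muF k : \sum_(0 <= i <oo) mu (F k i) < (mu^*)%mu X + k.+1%:R^-1%:E.
  by rewrite /F; case: cid => ? [].
have mUF k : measurable (\bigcup_i F k i).
  by apply: bigcupT_measurable => i; exact: (cover_measurable (XF k)).
have mG : measurable (\bigcap_k \bigcup_i F k i) by exact: bigcapT_measurable.
have XG : X `<=` \bigcap_k \bigcup_i F k i.
  by apply: sub_bigcap => k _; exact: (cover_subset (XF k)).
exists (\bigcap_k \bigcup_i F k i); split => //.
apply/eqP; rewrite eq_le; apply/andP; split; last first.
  by rewrite -measurable_mu_extE//; exact: le_mu_ext.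
apply/lee_addgt0Pr => _/posnumP[e]; near \oo => k.
apply: (@le_trans _ _ (mu (\bigcup_i F k i))).
  by apply: le_measure; rewrite ?inE//; exact: bigcap_inf.
have : mu (\bigcup_i F k i) <= \sum_(0 <= i <oo) mu (F k i).
  by apply: measure_sigma_subadditive => // i; exact: (cover_measurable (XF k)).
move=> /le_trans; apply; rewrite (le_trans (ltW (muF k)))// leeD// lee_fin ltW//.
by near: k; exact: near_infty_natSinv_lt.
Unshelve. all: by end_near. Qed.

Lemma mu_ext_negligible (X : set T) : (mu^*)%mu X = 0 -> mu.-negligible X.
Proof.
move=> X0; have [|G [mG XG GX]] := @mu_ext_measurable_hull X; first by rewrite X0.
by exists G; split => //; rewrite GX.
Qed.

(** Hulls are available only at finite outer measure, so [A] is cut along an exhaustion [F] and the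
    hulls of the pieces are united. Each piece contributes a null excess, and countably many null
    sets remain null. *)
Lemma caratheodory_sub_hull (A : set cT) : measurable A ->
  exists G : set T, [/\ measurable G, A `<=` G & mu.-negligible (G `\` A)].
Proof.
move=> mA; have /sigma_finiteP[F [TF ndF Foo]] := sigma_finiteT mu.
have hull k : exists G : set T, [/\ measurable G, A `&` F k `<=` G &
    mu.-negligible (G `\` A)].
  have [mF Fk] := Foo k.
  have AFoo : (mu^*)%mu (A `&` F k) < +oo.
    apply: le_lt_trans Fk; rewrite -[leRHS]measurable_mu_extE//.
    exact: le_mu_ext.
  have [G [mG XG GX]] := mu_ext_measurable_hull AFoo.
  exists (G `&` F k); split.
  - exact: measurableI.
  - by rewrite subsetI; split => //; exact: subIsetr.
  have GAF : (G `&` F k) `\` A `<=` G `\` (A `&` F k).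
    by move=> x [[Gx Fx] nA]; split => // -[].
  apply: negligibleS GAF _; apply: mu_ext_negligible.
  have mAF : measurable (A `&` F k : set cT).
    by apply: measurableI => //; exact: measurable_caratheodory.
  (* Carathéodory's criterion for the piece, tested on its hull. The hull has the same finite outer
     measure as the piece, so subtraction leaves measure zero for the excess. *)
  have : (mu^*)%mu G = ((mu^*)%mu (A `&` F k) + (mu^*)%mu (G `\` (A `&` F k)))%E.
    by rewrite -{1}(setIidr XG); exact: mAF.
  have -> : (mu^*)%mu G = (mu^*)%mu (A `&` F k) by rewrite -GX; exact: measurable_mu_extE.
  have afin : (mu^*)%mu (A `&` F k) \is a fin_num by rewrite ge0_fin_numE// mu_ext_ge0.
  move=> /(congr1 (fun z => z - (mu^*)%mu (A `&` F k))).
  by rewrite addeAC subee// add0e => /esym.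
pose G k := projT1 (cid (hull k)).
have GP k : [/\ measurable (G k), A `&` F k `<=` G k &
    mu.-negligible (G k `\` A)] by rewrite /G; case: cid.
exists (\bigcup_k G k); split.
- by apply: bigcupT_measurable => k; have [] := GP k.
- move=> x Ax; have : (\bigcup_k F k) x by rewrite -TF.
  by move=> [k _ Fx]; exists k => //; have [_ + _] := GP k; apply.
- rewrite setDE setI_bigcupl; apply: negligible_bigcup => k.
  by rewrite -setDE; have [] := GP k.
Qed.

(** The rational superlevel sets determine [u], and each has a measurable hull with negligible
    excess. [N] covers all these excesses; off [N] the superlevel sets agree with their hulls. *)
Lemma caratheodory_measurable_fun (u : cT -> R) : measurable_fun setT u ->
  exists N : set T, [/\ measurable N, mu N = 0 &
    measurable_fun setT (fun x : T => u x * \1_(~` N) x)%R].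
Proof.
move=> mu_.
have mlev (q : rat) : measurable ([set x | (ratr q < u x)%R] : set cT).
  rewrite -[X in measurable X]setTI.
  have -> : [set x : cT | (ratr q < u x)%R] = u @^-1` `]ratr q, +oo[%classic.
    by apply/seteqP; split => x /=; rewrite in_itv/= andbT.
  exact: mu_.
pose G q := projT1 (cid (caratheodory_sub_hull (mlev q))).
have GP q : [/\ measurable (G q), [set x | (ratr q < u x)%R] `<=` G q &
    mu.-negligible (G q `\` [set x | (ratr q < u x)%R])].
  by rewrite /G; case: cid.
(* The rationals are enumerated by [unpickle]; an index that codes no rational falls back on 0,
   which only repeats a set. *)
have : mu.-negligible (\bigcup_(k : nat)
    (G (odflt 0%R (unpickle k)) `\` [set x | (ratr (odflt 0%R (unpickle k)) < u x)%R])).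
  by apply: negligible_bigcup => k; have [] := GP (odflt 0%R (unpickle k)).
move=> [N [mN N0 subN]]; exists N; split => //.
have mlevN q : measurable ([set x | (ratr q < u x)%R] `&` ~` N : set T).
  have [mG uG _] := GP q.
  rewrite (_ : _ `&` _ = G q `&` ~` N).
    by apply: measurableI => //; exact: measurableC.
  apply/seteqP; split => x [] => [/uG//|Gx Nx]; split => //.
  apply: contrapT => ux; apply: Nx; apply: subN; exists (pickle q) => //.
  by rewrite pickleK.
have mlevr (a : R) : measurable ([set x | (a < u x)%R] `&` ~` N : set T).
  rewrite (_ : _ `&` _ = \bigcup_(q : rat)
    if (a < ratr q)%R then [set x | (ratr q < u x)%R] `&` ~` N else set0).
    by apply: bigcupT_measurable_rat => q; case: ifPn.
  apply/seteqP; split => x.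
    move=> [/= /rat_in_itvoo[q]]; rewrite in_itv/= => /andP[aq qu] Nx.
    by exists q => //; rewrite aq.
  by move=> [q _]; case: ifPn => //= aq [/(lt_trans aq)].
move=> _; apply: (measurability _ (measurable_realfun.RGenOInfty.measurableE R)) => //.
move=> /= _ [_ [a ->] <-]; rewrite preimage_itvoy setTI.
(* The modified function vanishes on [N], so its superlevel set at [a] misses [N] if [0 <= a] and
   contains [N] otherwise. *)
have [a0|a0] := leP 0%R a.
  rewrite (_ : [set x | _] = [set x | (a < u x)%R] `&` ~` N)//.
  apply/seteqP; split => x /=.
    rewrite indicE; have [Nx|Nx] := pselect (N x).
      by rewrite memNset ?mulr0 ?ltNge ?a0//=; apply.
    by rewrite mem_set// mulr1.
  by move=> [ax Nx]; rewrite indicE mem_set// mulr1.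
rewrite (_ : [set x | _] = ([set x | (a < u x)%R] `&` ~` N) `|` N).
  exact: measurableU.
apply/seteqP; split => x /=.
  rewrite indicE; have [Nx _|Nx] := pselect (N x); first by right.
  by rewrite mem_set// mulr1 => ?; left.
move=> [[ax Nx]|Nx]; first by rewrite indicE mem_set// mulr1.
by rewrite indicE memNset ?mulr0//=; apply.
Qed.

End completion.

(** * Homotheties *)

Section homothety.
Local Open Scope ereal_scope.
Context {R : realType}.

(** The pushforward of Lebesgue measure under [x |-> c + t x] is [t^-1] times Lebesgue measure,
    since both agree on half-open intervals. *)
Lemma ge0_integral_lebesgue_affine (c t : R) (f : measurableTypeR R -> \bar R) :
  (0 < t)%R ->
  measurable_fun setT f -> (forall x, 0 <= f x) ->
  \int[lebesgue_measure]_x f (c + t * x)%R =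
  t^-1%:E * \int[lebesgue_measure]_x f x.
Proof.
move=> t0 mf f0.
pose phi := (fun x : measurableTypeR R => (c + t * x)%R : measurableTypeR R).
have mphi : measurable_fun setT phi.
  by apply: measurable_funD => //; exact: measurable_funM.
have ti0 : (0 <= t^-1)%R by rewrite invr_ge0 ltW.
rewrite -(ge0_integral_mscale _ measurableT (NngNum ti0) mf)//.
have := ge0_integral_pushforward mphi lebesgue_measure measurableT mf.
rewrite preimage_setT => <-; last by move=> x _; exact: f0.
apply: eq_measure_integral => A mA _.
rewrite [RHS](_ : _ = t^-1%:E * lebesgue_measure A)//.
have [nu nuE] : exists nu : {measure set (measurableTypeR R) -> \bar R},
    forall A, nu A = lebesgue_measure (phi @^-1` A).
  by unshelve eexists (pushforward lebesgue_measure phi).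
have -> : lebesgue_measure A = mscale (NngNum (ltW t0)) nu A; last first.
  by rewrite /mscale/= nuE muleA -EFinM mulVf ?mul1e// gt_eqF.
apply: lebesgue_measure_unique => //= _ [[a b]] _ <-.
rewrite /mscale nuE /=.
have -> : phi @^-1` `]a, b] = `]((a - c) / t)%R, ((b - c) / t)%R]%classic.
  apply/seteqP; split => x /=; rewrite !in_itv/= /phi.
    by rewrite ltr_pdivrMr// ler_pdivlMr// ltrBlDl lerBrDl mulrC.
  by rewrite ltr_pdivrMr// ler_pdivlMr// ltrBlDl lerBrDl mulrC.
rewrite !lebesgue_measure_itv/= !lte_fin ltr_pM2r ?invr_gt0// ltrD2r.
case: ifPn => _; last by rewrite mule0.
by rewrite -!EFinD -EFinM; congr EFin; field; rewrite gt_eqF.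
Qed.

Lemma rV_consE_ord0 n (z : R * 'rV[R]_n) : rV_cons z ord0 ord0 = z.1.
Proof.
rewrite /rV_cons (_ : ord0 = lshift n (@ord0 0)); last exact: val_inj.
by rewrite [LHS](@row_mxEl R 1 1 n) mxE.
Qed.

Lemma rV_consE_lift n (z : R * 'rV[R]_n) (j : 'I_n) :
  rV_cons z ord0 (lift ord0 j) = z.2 ord0 j.
Proof.
rewrite /rV_cons (_ : lift ord0 j = rshift 1 j); last exact: val_inj.
exact: (@row_mxEr R 1 1 n).
Qed.

Lemma measurable_rV_cons2 n (a : R) :
  measurable_fun setT (fun v : 'rV[R]_n => rV_cons (a, v)).
Proof.
apply: measurable_fun_rV => i; case: (unliftP ord0 i) => [j|] ->.
  under eq_fun do rewrite rV_consE_lift; exact: measurable_coord.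
under eq_fun do rewrite rV_consE_ord0/=; exact: measurable_cst.
Qed.

Lemma measurable_rV_affine n (c : 'rV[R]_n) (t : R) :
  measurable_fun setT (fun x : 'rV[R]_n => (c + t *: x)%R).
Proof.
apply: measurable_fun_rV => i.
rewrite (_ : (fun _ => _) = (fun x : 'rV[R]_n => c ord0 i + t * x ord0 i)%R).
  apply: measurable_funD => //; apply: measurable_funM => //.
  exact: measurable_coord.
by apply/funext => x; rewrite !mxE.
Qed.

Let measurable_consR n : measurable_fun setT
  (@rV_cons R n : measurableTypeR R * 'rV[R]_n -> 'rV[R]_n.+1).
Proof. exact: measurable_rV_cons. Qed.

Lemma ge0_integral_borel_lebesgueS n (f : 'rV[R]_n.+1 -> \bar R) :
  measurable_fun setT f -> (forall x, 0 <= f x) ->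
  \int[@borel_lebesgue R n.+1]_x f x =
  \int[lebesgue_measure]_a \int[@borel_lebesgue R n]_v f (rV_cons (a, v)).
Proof.
move=> mf f0.
have := ge0_integral_pushforward (@measurable_consR n)
  (lebesgue_measure \x @borel_lebesgue R n) measurableT mf.
rewrite preimage_setT => /(_ (fun x _ => f0 x)) pushE.
transitivity (\int[lebesgue_measure \x @borel_lebesgue R n]_z
    (f \o @rV_cons R n) z).
  etransitivity; last exact: pushE.
  by apply: eq_measure_integral => //; exact: measurable_consR.
have mfcons := measurableT_comp mf (@measurable_consR n).
by rewrite (fubini_tonelli1 _ mfcons (fun z => f0 _)).
Qed.

(** Induction on the dimension: splitting off the first coordinate by Tonelli, each coordinate
    contributes one factor [t^-1]. *)
Lemma ge0_integral_borel_lebesgue_affine n (c : 'rV[R]_n) (t : R)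
    (f : 'rV[R]_n -> \bar R) : (0 < t)%R ->
  measurable_fun setT f -> (forall x, 0 <= f x) ->
  \int[@borel_lebesgue R n]_x f (c + t *: x)%R =
  (t^-1 ^+ n)%:E * \int[@borel_lebesgue R n]_x f x.
Proof.
elim: n c f => [|n ih] c f t0 mf f0.
  rewrite expr0 mul1e; apply: eq_integral => x _.
  by congr f; apply/rowP => -[].
have mfc : measurable_fun setT (fun x : 'rV[R]_n.+1 => f (c + t *: x)%R).
  exact: (measurableT_comp mf (measurable_rV_affine c t)).
rewrite !ge0_integral_borel_lebesgueS//.
pose c' : 'rV[R]_n := \row_j c ord0 (lift ord0 j).
have consE a v : (c + t *: rV_cons (a, v))%R =
    rV_cons ((c ord0 ord0 + t * a)%R, (c' + t *: v)%R).
  apply/rowP => i; case: (unliftP ord0 i) => [j|] ->.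
    by rewrite !(rV_consE_lift, mxE).
  by rewrite !(rV_consE_ord0, mxE).
have mfcons : measurable_fun setT
    (f \o @rV_cons R n : measurableTypeR R * 'rV[R]_n -> \bar R).
  exact: (measurableT_comp mf (@measurable_consR n)).
pose F a := \int[@borel_lebesgue R n]_v f (rV_cons (a, v)).
have mF : measurable_fun setT F.
  exact: (measurable_fun_fubini_tonelli_F (f \o @rV_cons R n) mfcons (fun z => f0 _)).
have F0 a : 0 <= F a by exact: integral_ge0.
pose G (a : measurableTypeR R) := F (c ord0 ord0 + t * a)%R.
have mG : measurable_fun setT G.
  apply: (measurableT_comp mF).
  by apply: measurable_funD => //; exact: measurable_funM.
have tn0 : 0 <= (t^-1 ^+ n)%:E by rewrite lee_fin exprn_ge0// invr_ge0 ltW.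
transitivity (\int[lebesgue_measure]_a ((t^-1 ^+ n)%:E * G a)).
  apply: eq_integral => a _; rewrite /G /F -(ih c')//.
    by apply: eq_integral => v _; rewrite consE.
  by apply: (measurableT_comp mf); exact: measurable_rV_cons2.
rewrite (ge0_integralZl _ measurableT mG (fun x _ => F0 _) tn0).
rewrite [X in _ * X](ge0_integral_lebesgue_affine (f := F) (c ord0 ord0) t0 mF F0).
by rewrite exprSr EFinM muleA.
Qed.

End homothety.

(* The library has another [edist], the extended distance. *)
Local Notation edist := Defs.edist.

(** * Euclidean balls and midpoints *)

Section enorm.
Context {R : realType} {n : nat}.
Implicit Types x y c : 'rV[R]_n.

Definition midpoint x y : 'rV[R]_n := 2^-1 *: x + 2^-1 *: y.

Lemma midpointC x y : midpoint x y = midpoint y x.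
Proof. by rewrite /midpoint addrC. Qed.

Lemma enorm_ge0 x : 0 <= enorm x.
Proof. exact: sqrtr_ge0. Qed.

Lemma enormZ (a : R) x : 0 <= a -> enorm (a *: x) = a * enorm x.
Proof.
move=> a0; rewrite /enorm -[in RHS](ger0_norm a0) -sqrtr_sqr -sqrtrM ?sqr_ge0// mulr_sumr.
by congr Num.sqrt; apply: eq_bigr => i _; rewrite mxE exprMn.
Qed.

Lemma enormN x : enorm (- x) = enorm x.
Proof. by congr Num.sqrt; apply: eq_bigr => i _; rewrite mxE sqrrN. Qed.

Lemma enorm_sum_ge0 x : 0 <= \sum_i x ord0 i ^+ 2.
Proof. by apply: sumr_ge0 => i _; exact: sqr_ge0. Qed.

Lemma enorm_lt x (r : R) : 0 < r -> (enorm x < r) = (\sum_i x ord0 i ^+ 2 < r ^+ 2).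
Proof.
by move=> r0; rewrite /enorm -{1}(ger0_norm (ltW r0)) -sqrtr_sqr ltr_sqrt// exprn_gt0.
Qed.

Lemma enorm_eq0 x : enorm x = 0 -> x = 0.
Proof.
move=> /eqP; rewrite sqrtr_eq0 => x0; apply/rowP => i; rewrite mxE; apply/eqP.
have := @psumr_eq0P _ _ predT (fun i => x ord0 i ^+ 2) (fun i _ => sqr_ge0 _).
move=> /(_ _ i isT) /eqP; rewrite sqrf_eq0; apply.
by apply/eqP; rewrite eq_le x0 enorm_sum_ge0.
Qed.

Lemma edist_eq0 x y : edist x y = 0 -> x = y.
Proof. by move=> /enorm_eq0 /eqP; rewrite subr_eq0 => /eqP. Qed.

Lemma edist_midpointl x y : edist x (midpoint x y) = 2^-1 * edist x y.
Proof.
rewrite /edist /midpoint -enormZ ?invr_ge0//; congr enorm.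
by apply/rowP => i; rewrite !mxE; field.
Qed.

Lemma edistC x y : edist x y = edist y x.
Proof. by rewrite /edist -enormN opprB. Qed.

(* The parallelogram identity spares the triangle inequality here and below. *)
Lemma edist_ball_lt c x y (r : R) : 0 < r -> edist x c < r -> edist y c < r ->
  edist x y < 2 * r.
Proof.
move=> r0; rewrite !enorm_lt ?mulr_gt0// => xc yc.
have : \sum_i (x - y) ord0 i ^+ 2 <=
    2 * \sum_i (x - c) ord0 i ^+ 2 + 2 * \sum_i (y - c) ord0 i ^+ 2.
  rewrite !mulr_sumr -big_split/=; apply: ler_sum => i _; rewrite !mxE.
  by have := sqr_ge0 (x ord0 i + y ord0 i - 2 * c ord0 i); nra.
by move=> /le_lt_trans; apply; rewrite exprMn; lra.
Qed.

Lemma edist_midpoint_ball c x y (r : R) : 0 < r -> edist x c < r -> edist y c < r ->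
  edist (midpoint x y) c < r.
Proof.
move=> r0; rewrite !enorm_lt// => xc yc.
have : \sum_i (midpoint x y - c) ord0 i ^+ 2 <=
    2^-1 * \sum_i (x - c) ord0 i ^+ 2 + 2^-1 * \sum_i (y - c) ord0 i ^+ 2.
  rewrite !mulr_sumr -big_split/=; apply: ler_sum => i _; rewrite !mxE.
  by have := sqr_ge0 (x ord0 i - y ord0 i); nra.
by move=> /le_lt_trans; apply; lra.
Qed.

Lemma measurable_edist :
  measurable_fun setT (fun z : 'rV[R]_n * 'rV[R]_n => edist z.1 z.2).
Proof.
rewrite (_ : (fun _ => _) = (fun z : 'rV[R]_n * 'rV[R]_n =>
  (\sum_i (z.1 ord0 i - z.2 ord0 i) ^+ 2) `^ 2^-1)); last first.
  apply/funext => z; rewrite /edist /enorm powR12_sqrt ?sumr_ge0//.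
    by congr Num.sqrt; apply: eq_bigr => i _; rewrite !mxE.
  by move=> i _; exact: sqr_ge0.
apply: (measurableT_comp (measurable_powR 2^-1)).
apply: measurable_sum => i; apply: measurable_funX; apply: measurable_funB.
  exact: (measurableT_comp (measurable_coord i) measurable_fst).
exact: (measurableT_comp (measurable_coord i) measurable_snd).
Qed.

Lemma measurable_midpoint :
  measurable_fun setT (fun z : 'rV[R]_n * 'rV[R]_n => midpoint z.1 z.2).
Proof.
apply: measurable_fun_rV => i.
rewrite (_ : (fun _ => _) = (fun z : 'rV[R]_n * 'rV[R]_n =>
  2^-1 * z.1 ord0 i + 2^-1 * z.2 ord0 i)); last first.
  by apply/funext => z; rewrite !mxE.
apply: measurable_funD; apply: measurable_funM => //.
  exact: (measurableT_comp (measurable_coord i) measurable_fst).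
exact: (measurableT_comp (measurable_coord i) measurable_snd).
Qed.

Lemma measurable_eball c (r : R) : measurable [set y : 'rV[R]_n | edist c y < r].
Proof.
rewrite -[X in measurable X]setTI.
have -> : [set y | edist c y < r] = (fun y => edist c y) @^-1` `]-oo, r[%classic.
  by apply/seteqP; split => y /=; rewrite in_itv.
have mc : measurable_fun setT (fun y : 'rV[R]_n => (c, y)).
  by apply: measurable_fun_pair => //; exact: measurable_cst.
by have := measurableT_comp measurable_edist mc; apply.
Qed.

End enorm.

(** * Change of variables to the midpoint in double integrals *)

Section product_integrals.
Local Open Scope ereal_scope.
Context {R : realType} {n : nat}.
Local Notation V := 'rV[R]_n.
Local Notation mu := (@borel_lebesgue R n).
Implicit Type f : V * V -> \bar R.

Lemma ge0_integral_prod_swap f : measurable_fun setT f -> (forall z, 0 <= f z) ->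
  \int[mu \x mu]_z f (z.2, z.1) = \int[mu \x mu]_z f z.
Proof.
move=> mf f0; have mfs : measurable_fun setT (fun z : V * V => f (z.2, z.1)).
  by apply: (measurableT_comp mf); apply: measurable_fun_pair.
by rewrite (fubini_tonelli1 _ mfs)// [RHS](fubini_tonelli2 _ mf).
Qed.

(** For fixed [x], the map from [y] to the midpoint is a homothety of ratio 1/2 centred at [x], with
    Jacobian factor [2 ^+ n]. *)
Lemma ge0_integral_midpointl f : measurable_fun setT f -> (forall z, 0 <= f z) ->
  \int[mu \x mu]_z f (z.1, midpoint z.1 z.2) = (2 ^+ n)%:E * \int[mu \x mu]_z f z.
Proof.
move=> mf f0.
have mfs : measurable_fun setT (fun z : V * V => f (z.1, midpoint z.1 z.2)).
  apply: (measurableT_comp mf); apply: measurable_fun_pair => //.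
  exact: measurable_midpoint.
rewrite (fubini_tonelli1 _ mfs)// [in RHS](fubini_tonelli1 _ mf)// -ge0_integralZl//.
- apply: eq_integral => x _; rewrite /fubini_F/=.
  have mfx : measurable_fun setT (fun y => f (x, y)).
    by apply: (measurableT_comp mf); apply: measurable_fun_pair.
  have h0 : (0 < 2^-1 :> R)%R by rewrite invr_gt0.
  have := ge0_integral_borel_lebesgue_affine (2^-1 *: x)%R h0 mfx (fun y => f0 _).
  by rewrite invrK.
- exact: measurable_fun_fubini_tonelli_F.
- by move=> x _; exact: integral_ge0.
Qed.

Lemma ge0_integral_midpointr f : measurable_fun setT f -> (forall z, 0 <= f z) ->
  \int[mu \x mu]_z f (z.2, midpoint z.1 z.2) = (2 ^+ n)%:E * \int[mu \x mu]_z f z.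
Proof.
move=> mf f0; rewrite -ge0_integral_midpointl//.
rewrite -(ge0_integral_prod_swap (f := fun z => f (z.1, midpoint z.1 z.2)))//.
  by apply: eq_integral => z _ /=; rewrite midpointC.
apply: (measurableT_comp mf); apply: measurable_fun_pair => //.
exact: measurable_midpoint.
Qed.

End product_integrals.

(** * The estimate for Borel functions *)

Section truncation.
Context {R : realType}.

(** The [phi_c] of the overview. The threshold [c] allows a finite number of levels to suffice; the
    cap [T] makes up for the absence of levels [delta >= 1]. *)
Definition trunc (T c t : R) : R := Num.max 0 (Num.min t T - c).

Lemma trunc_ge0 T c t : 0 <= trunc T c t.
Proof. by rewrite le_max lexx. Qed.

(** Capping at [T] is subadditive on nonnegative numbers, and each of the two summands loses at most
    [c], which the doubled threshold pays for. *)
Lemma trunc_triangle T c s s' t : 0 <= T -> 0 <= s -> 0 <= s' -> t <= s + s' ->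
  trunc T (2 * c) t <= trunc T c s + trunc T c s'.
Proof.
move=> T0 s0 s'0 tss'; rewrite /trunc.
set a := Num.min t T; set b := Num.min s T; set b' := Num.min s' T.
have abb' : a <= b + b'.
  rewrite /a /b /b'.
  by case: (leP s T) => ?; case: (leP s' T) => ?; rewrite ge_min; apply/orP;
    (try by left; lra); right; lra.
case: (leP 0 (b - c)) => ?; case: (leP 0 (b' - c)) => ?;
  rewrite ge_max; apply/andP; split; lra.
Qed.

Lemma trunc_mono T c c' t : c <= c' -> trunc T c' t <= trunc T c t.
Proof.
move=> cc'; rewrite /trunc ge_max !le_max lexx/=.
by apply/orP; right; rewrite lerB.
Qed.

(** Halving the threshold [e] raises the truncation by at most [e / 2], the weight of the new level;
    if [t <= e / 2] the new truncation is 0. *)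
Lemma trunc1_le_sum_levels (t : R) (J : nat) :
  trunc 1 (2^-1 ^+ J) t <=
  \sum_(j < J) 2^-1 ^+ j.+1 * (2^-1 ^+ j.+1 < t)%R%:R.
Proof.
elim: J => [|J ih].
  rewrite big_ord0 expr0 /trunc ge_max lexx/= subr_le0 ge_min lexx orbT//.
rewrite big_ord_recr/=; move: ih; rewrite /trunc exprS.
set S := \sum_(j < J) _; set e := 2^-1 ^+ J => ih.
have e0 : 0 < e by rewrite exprn_gt0.
have S0 : 0 <= S by apply: sumr_ge0 => j _; rewrite mulr_ge0// exprn_ge0.
have [te|te] := ltP (2^-1 * e) t; rewrite /= ?mulr1 ?mulr0 ?addr0.
  move: ih; rewrite !ge_max => /andP[_ ih]; apply/andP; split; first lra.
  by move: ih; set m := Num.min _ _; lra.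
rewrite ge_max S0/=; have : Num.min t 1 <= t by rewrite ge_min lexx.
by lra.
Qed.

(** The caps [T] and [1] differ only for [t > 1]. The level [2^-1] is then exceeded, and [2 * T]
    times its weight [2^-1] supplies the whole cap [T]. *)
Lemma trunc_le_sum_levels (T t : R) (J : nat) : 1 <= T ->
  trunc T (2^-1 ^+ J) t <=
  \sum_(j < J) 2^-1 ^+ j.+1 * (2^-1 ^+ j.+1 < t)%R%:R +
  2 * T * (2^-1 * (2^-1 < t)%R%:R).
Proof.
move=> T1; apply: (@le_trans _ _ (trunc 1 (2^-1 ^+ J) t +
    2 * T * (2^-1 * (2^-1 < t)%R%:R))); last first.
  by rewrite lerD2r trunc1_le_sum_levels.
have e0 : 0 < 2^-1 ^+ J :> R by rewrite exprn_gt0.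
have [t1|t1] := leP t 1.
  rewrite (_ : trunc T _ t = trunc 1 (2^-1 ^+ J) t).
    by rewrite lerDl !mulr_ge0// (le_trans _ T1).
  by rewrite /trunc !min_l// (le_trans t1).
have -> : (2^-1 < t)%R by lra.
have := trunc_ge0 1 (2^-1 ^+ J) t.
rewrite {2}/trunc ge_max => ?.
have : Num.min t T <= T by rewrite ge_min lexx orbT.
by move=> ?; apply/andP; split; rewrite /=; lra.
Qed.

(** This rebuilds the kernel [tau^-(m+1)] from dyadic scales. The weights at least double from one
    [k] to the next, so the sum is at most twice its last active term, where
    [2 ^+ k < rho / tau]. *)
Lemma sum_dyadic_le (rho tau : R) (m K : nat) : 0 < rho -> 0 < tau ->
  \sum_(k < K) 2 ^+ (k * m.+1) * (tau < rho * 2^-1 ^+ k)%R%:R <=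
  2 * (rho / tau) ^+ m.+1.
Proof.
move=> rho0 tau0.
have q2 : 2 <= 2 ^+ m.+1 :> R.
  by rewrite exprS ler_peMr// exprn_ege1// ler1n.
have geo j : \sum_(k < j) 2 ^+ (k * m.+1) <= 2 ^+ (j * m.+1) :> R.
  elim: j => [|j ih]; first by rewrite big_ord0 mul0n expr0.
  rewrite big_ord_recr/= mulSn exprD.
  have := ler_wpM2r (exprn_ge0 (j * m.+1) (ltW (ltr0Sn R 1))) q2.
  by move: ih; lra.
elim: K => [|K ih].
  by rewrite big_ord0 mulr_ge0// exprn_ge0// divr_ge0// ltW.
have [h|h] := ltP tau (rho * 2^-1 ^+ K); last first.
  by rewrite big_ord_recr/= ltNge h mulr0 addr0.
apply: (@le_trans _ _ (\sum_(k < K.+1) 2 ^+ (k * m.+1))).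
  apply: ler_sum => k _; rewrite ler_piMr ?exprn_ge0//.
  by case: (_ < _)%R; rewrite ?ler01 ?lexx.
have hK : 2 ^+ (K * m.+1) <= (rho / tau) ^+ m.+1 :> R.
  rewrite exprM lerXn2r ?nnegrE ?exprn_ge0 ?divr_ge0 ?ltW//.
  by rewrite ltr_pdivlMr// mulrC -ltr_pdivlMr ?exprn_gt0// -exprVn.
by rewrite big_ord_recr/=; have := geo K; lra.
Qed.

End truncation.

(** Archimedean form of dividing by [K] and letting [K] grow: if [C < I], any [K] above
    [C * a / (I - C)] contradicts the bound. *)
Lemma le_of_natmul_le {R : realType} (I C a : R) :
  (forall K : nat, K%:R * I <= C * (K%:R + a)) -> I <= C.
Proof.
move=> h; rewrite leNgt; apply/negP => CI.
have IC : 0 < I - C by lra.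
have := h (Num.bound `|C * a / (I - C)|).
have := archi_boundP (normr_ge0 (C * a / (I - C))).
set K := (Num.bound _)%:R => aK.
have : C * a < K * (I - C).
  by rewrite -ltr_pdivrMr//; exact: le_lt_trans (ler_norm _) aK.
by nra.
Qed.

(** A single parameter [s] raises the cap and lowers the threshold together, so one monotone
    convergence will remove both. *)
Lemma cvg_trunc {R : realType} (t : R) : 0 <= t ->
  (fun s : nat => trunc s.+1%:R (2^-1 ^+ s) t) @ \oo --> t.
Proof.
move=> t0; apply: (@squeeze_cvgr _ _ _ _ (fun s : nat => t - 2^-1 ^+ s) (fun=> t)).
- near=> s; have e0 : 0 < 2^-1 ^+ s :> R by rewrite exprn_gt0.
  have ts : t <= s.+1%:R.
    have : t <= (Num.bound t)%:R by exact/ltW/archi_boundP.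
    move=> /le_trans; apply; rewrite ler_nat; apply: leqW.
    by near: s; exists (Num.bound t).
  rewrite /trunc min_l// ge_max le_max t0 lexx orbT/=.
  by lra.
- rewrite -[X in _ --> X]subr0; apply: cvgB; first exact: cvg_cst.
  by apply: cvg_expr; rewrite ger0_norm ?invr_ge0// invf_lt1// ltr1n.
- exact: cvg_cst.
Unshelve. all: by end_near. Qed.

(** * Dyadic iteration on a midpoint-closed set of diameter at most [rho] *)

Section oscillation.
Context {R : realType} {n : nat}.
Local Notation V := 'rV[R]_n.
Local Notation mu := (@borel_lebesgue R n).
Variables (v : V -> R) (B : set V) (rho : R).
Hypothesis mv : measurable_fun setT v.
Hypothesis mB : measurable B.
Hypothesis rho_gt0 : 0 < rho.
Hypothesis B_midpoint : forall x y, B x -> B y -> B (midpoint x y).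
Hypothesis B_diam : forall x y, B x -> B y -> edist x y < rho.

Let d (z : V * V) : R := `|v z.1 - v z.2|.
Let BB (z : V * V) : R := \1_B z.1 * \1_B z.2.
Let near k (z : V * V) : R := (edist z.1 z.2 < rho * 2^-1 ^+ k)%R%:R.
Let G k T c z : R := BB z * near k z * trunc T c (d z).

(** The integrand of [truncated_energy] at exponent 1, restricted to pairs in [B] and written as a
    total function. *)
Definition level (delta : R) (z : V * V) : R :=
  BB z * ((delta < d z)%R%:R * (delta / edist z.1 z.2 ^+ n.+1)).

Let BB_ge0 z : 0 <= BB z.
Proof. by rewrite mulr_ge0. Qed.

Let G_ge0 k T c z : 0 <= G k T c z.
Proof. by rewrite !mulr_ge0// trunc_ge0. Qed.

#[local] Hint Resolve BB_ge0 G_ge0 : core.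

Lemma level_ge0 delta z : 0 <= delta -> 0 <= level delta z.
Proof.
by move=> d0; rewrite !mulr_ge0// invr_ge0 exprn_ge0// enorm_ge0.
Qed.

Let measurable_d : measurable_fun setT d.
Proof.
apply: measurableT_comp => //; apply: measurable_funB.
  exact: (measurableT_comp mv measurable_fst).
exact: (measurableT_comp mv measurable_snd).
Qed.

Let measurable_BB : measurable_fun setT BB.
Proof.
have mi := measurable_indic (R := R) (D := setT) mB.
apply: measurable_funM.
  exact: (measurableT_comp mi measurable_fst).
exact: (measurableT_comp mi measurable_snd).
Qed.

Let measurable_natr_bool d' (T : measurableType d') (b : T -> bool) :
  measurable_fun setT b -> measurable_fun setT (fun x => (b x)%:R : R).
Proof.
move=> mb; rewrite (_ : (fun _ => _) = fun x => if b x then 1 else 0).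
  exact: measurable_fun_ifT.
by apply/funext => x; case: (b x).
Qed.

Let measurable_G k T c : measurable_fun setT (G k T c).
Proof.
apply: measurable_funM; last first.
  apply: measurable_maxr => //; apply: measurable_funB => //.
  exact: measurable_minr.
apply: measurable_funM => //; apply: measurable_natr_bool.
by apply: measurable_fun_ltr => //; exact: measurable_edist.
Qed.

Lemma measurable_level delta : measurable_fun setT (level delta).
Proof.
apply: measurable_funM => //; apply: measurable_funM.
  by apply: measurable_natr_bool; exact: measurable_fun_ltr.
apply: measurable_funM => //.
rewrite (_ : (fun _ => _) = fun z => edist z.1 z.2 `^ (- n.+1%:R)).
  exact: (measurableT_comp (measurable_powR _) measurable_edist).
by apply/funext => z; rewrite powRN powR_mulrn// enorm_ge0.
Qed.

Local Open Scope ereal_scope.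

Let I k T c : \bar R := \int[mu \x mu]_z (G k T c z)%:E.

(** The midpoint of a pair in [B] stays in [B] and halves the distance, so both half-pairs live at
    scale [k.+1]; [trunc_triangle] splits the oscillation between them. *)
Let G_step k T c z : (0 <= T)%R ->
  (G k T (2 * c) z <=
   G k.+1 T c (z.1, midpoint z.1 z.2) + G k.+1 T c (z.2, midpoint z.1 z.2))%R.
Proof.
move=> T0; case: z => x y.
have rhs0 : (0 <= G k.+1 T c (x, midpoint x y) + G k.+1 T c (y, midpoint x y))%R.
  by rewrite addr_ge0.
have [Bx|Bx] := pselect (B x); last first.
  by rewrite {1}/G {1}/BB /= [X in (X * _ * _ * _)%R]indicE memNset// !mul0r.
have [By|By] := pselect (B y); last first.
  by rewrite {1}/G {1}/BB /= [X in (_ * X * _ * _ <= _)%R]indicE memNset// mulr0 !mul0r.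
rewrite /G /BB /near /= !indicE !mem_set//; last exact: B_midpoint.
rewrite !mulr1 !mul1r.
have [xy|_] := ltP (edist x y); last first.
  by rewrite mulr0n mul0r addr_ge0// mulr_ge0// trunc_ge0.
rewrite mulr1n.
rewrite [in X in (_ <= _ + X)%R]midpointC !edist_midpointl (edistC y x).
have -> : (2^-1 * edist x y < rho * 2^-1 ^+ k.+1)%R by rewrite exprS; lra.
rewrite mulr1n !mul1r (midpointC y); apply: trunc_triangle; rewrite /d ?normr_ge0//=.
rewrite (distrC (v y)); apply: le_trans (ler_normD _ _).
by rewrite subrKA.
Qed.

Let I_step k T c : (0 <= T)%R -> I k T (2 * c) <= (2 ^+ n.+1)%:E * I k.+1 T c.
Proof.
move=> T0.
have mGE : measurable_fun setT (fun z => (G k.+1 T c z)%:E).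
  by apply/measurable_EFinP; exact: measurable_G.
have mpl : measurable_fun setT (fun z : V * V => (z.1, midpoint z.1 z.2)).
  by apply: measurable_fun_pair => //; exact: measurable_midpoint.
have mpr : measurable_fun setT (fun z : V * V => (z.2, midpoint z.1 z.2)).
  by apply: measurable_fun_pair => //; exact: measurable_midpoint.
have ml := measurableT_comp mGE mpl.
have mr := measurableT_comp mGE mpr.
apply: (@le_trans _ _ (\int[mu \x mu]_z
  ((G k.+1 T c (z.1, midpoint z.1 z.2))%:E +
   (G k.+1 T c (z.2, midpoint z.1 z.2))%:E))).
  apply: ge0_le_integral => //.
  - by move=> z _; rewrite lee_fin.
  - by apply/measurable_EFinP; exact: measurable_G.
  - exact: emeasurable_funD ml mr.
  - by move=> z _; rewrite -EFinD lee_fin G_step.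
rewrite ge0_integralD//; last 2 first.
- by move=> z _; rewrite lee_fin.
- by move=> z _; rewrite lee_fin.
have GE0 z : 0 <= (G k.+1 T c z)%:E by rewrite lee_fin.
have -> := ge0_integral_midpointl mGE GE0.
have -> := ge0_integral_midpointr mGE GE0.
(* Each half-pair costs the Jacobian [2 ^+ n]; the two together give [2 ^+ n.+1]. *)
by rewrite -ge0_muleDl ?lee_fin ?exprn_ge0// -EFinD -mulr2n -[(_ *+ 2)%R]mulr_natl -exprS.
Qed.

Let I_iter k T c : (0 <= T)%R ->
  I 0 T (2 ^+ k * c) <= (2 ^+ (k * n.+1))%:E * I k T c.
Proof.
move=> T0; elim: k c => [|k ih] c; first by rewrite mul0n !expr0 mul1e mul1r.
rewrite exprSr -mulrA; apply: (le_trans (ih _)).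
rewrite mulSn addnC exprD EFinM -muleA lee_pmul2l ?lte_fin ?exprn_gt0//.
exact: I_step.
Qed.

(** The sum over scales produces the kernel by [sum_dyadic_le], and the truncation is spread over
    levels by [trunc_le_sum_levels]; their product is a sum of energy integrands. *)
Let sum_G_le T K J z : (1 <= T)%R ->
  (\sum_(k < K) 2 ^+ (k * n.+1) * G k T (2^-1 ^+ J) z <=
   2 * rho ^+ n.+1 * (\sum_(j < J) level (2^-1 ^+ j.+1) z +
                      2 * T * level 2^-1 z))%R.
Proof.
move=> T1; have T0 : (0 <= T)%R by lra.
have rn0 : (0 <= 2 * rho ^+ n.+1)%R by rewrite mulr_ge0// exprn_ge0// ltW.
have lev0 j : (0 <= level (2^-1 ^+ j.+1) z)%R by rewrite level_ge0// exprn_ge0.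
have rhs0 : (0 <= \sum_(j < J) level (2^-1 ^+ j.+1) z + 2 * T * level 2^-1 z)%R.
  apply: addr_ge0; first exact: sumr_ge0.
  by apply: mulr_ge0; [rewrite mulr_ge0|rewrite level_ge0].
(* On the diagonal the oscillation vanishes and so does the left side; elsewhere the distance [tau]
   is positive and may be divided by. *)
have := enorm_ge0 (z.1 - z.2); rewrite le_eqVlt => /predU1P[/esym/edist_eq0 z12|tau0].
  rewrite big1 => [|k _]; first exact: mulr_ge0 rn0 rhs0.
  rewrite /G /d z12 subrr normr0.
  rewrite /trunc min_l// (_ : Num.max 0 _ = 0)%R ?mulr0//.
  by apply/max_idPl; rewrite sub0r oppr_le0 exprn_ge0.
set tau := enorm _ in tau0.
have -> : (\sum_(k < K) 2 ^+ (k * n.+1) * G k T (2^-1 ^+ J) z =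
    BB z * trunc T (2^-1 ^+ J) (d z) *
    \sum_(k < K) 2 ^+ (k * n.+1) * (tau < rho * 2^-1 ^+ k)%R%:R)%R.
  by rewrite mulr_sumr; apply: eq_bigr => k _; rewrite /G /near -/tau; ring.
have Bt0 : (0 <= BB z * trunc T (2^-1 ^+ J) (d z))%R.
  by rewrite mulr_ge0// trunc_ge0.
apply: (le_trans (ler_wpM2l Bt0 (sum_dyadic_le n K rho_gt0 tau0))).
have taun0 : (0 < tau ^+ n.+1)%R by rewrite exprn_gt0.
apply: (@le_trans _ _ (2 * rho ^+ n.+1 * (BB z * (trunc T (2^-1 ^+ J) (d z) /
    tau ^+ n.+1))))%R.
  by rewrite expr_div_n le_eqVlt; apply/orP; left; apply/eqP; ring.
rewrite ler_wpM2l//.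
apply: (@le_trans _ _ (BB z * ((\sum_(j < J) 2^-1 ^+ j.+1 *
    (2^-1 ^+ j.+1 < d z)%R%:R + 2 * T * (2^-1 * (2^-1 < d z)%R%:R)) / tau ^+ n.+1)))%R.
  rewrite ler_wpM2l// ler_wpM2r ?invr_ge0 ?(ltW taun0)//.
  exact: trunc_le_sum_levels.
rewrite mulrDl mulrDr mulr_suml mulr_sumr le_eqVlt; apply/orP; left; apply/eqP.
congr (_ + _)%R; last by rewrite /level -/tau; ring.
by apply: eq_bigr => j _; rewrite /level -/tau; ring.
Qed.

Variable M : R.
Hypothesis level_le : forall delta, (0 < delta < 1)%R ->
  \int[mu \x mu]_z (level delta z)%:E <= M%:E.

Let I_le_trunc T s K : (1 <= T)%R ->
  K%:R%:E * I 0 T (2^-1 ^+ s) <=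
  (2 * rho ^+ n.+1 * M * (K%:R + (s%:R + 2 * T)))%:E.
Proof.
move=> T1; have T0 : (0 <= T)%R by lra.
(* With this [J] every threshold [2^-1 ^+ (s + k)], [k < K], is at least [2^-1 ^+ J], so one family
   of levels serves all scales. *)
pose J := (s + K)%N.
have rn0 : (0 <= 2 * rho ^+ n.+1)%R by rewrite mulr_ge0// exprn_ge0// ltW.
have lev0 j z : (0 <= level (2^-1 ^+ j.+1) z)%R by rewrite level_ge0// exprn_ge0.
have lev20 z : (0 <= level 2^-1 z)%R by rewrite level_ge0.
have mlev delta : measurable_fun setT (fun z => (level delta z)%:E).
  by apply/measurable_EFinP; exact: measurable_level.
have mG k c : measurable_fun setT (fun z => (G k T c z)%:E).
  by apply/measurable_EFinP; exact: measurable_G.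
apply: (@le_trans _ _ (\sum_(k < K) (2 ^+ (k * n.+1))%:E * I k T (2^-1 ^+ J))).
  (* The product is read as [K] copies of [I 0]; copy [k] is then moved to scale [k] by [I_iter], at
     threshold [2^-1 ^+ (s + k)]. *)
  have -> : K%:R%:E * I 0 T (2^-1 ^+ s) = \sum_(k < K) I 0 T (2^-1 ^+ s).
    elim: K {J} => [|K ih]; first by rewrite big_ord0 mul0e.
    rewrite big_ord_recr/= -ih -[X in _ + X]mul1e -ge0_muleDl ?lee_fin//.
    by rewrite -EFinD natr1.
  apply: lee_sum => k _.
  have -> : (2^-1 ^+ s = 2 ^+ k * 2^-1 ^+ (s + k) :> R)%R.
    by rewrite exprD mulrCA -exprMn divff ?expr1n ?mulr1.
  apply: (le_trans (I_iter _ _ T0)); rewrite lee_pmul2l ?lte_fin ?exprn_gt0//.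
  apply: ge0_le_integral => //.
  - by move=> z _; rewrite lee_fin.
  - move=> z _; rewrite lee_fin ler_wpM2l ?mulr_ge0//.
    apply: trunc_mono; rewrite ler_wiXn2l ?invr_ge0 ?invf_le1 ?ler1n//.
    by rewrite leq_add2l ltnW.
have -> : \sum_(k < K) (2 ^+ (k * n.+1))%:E * I k T (2^-1 ^+ J) =
    \int[mu \x mu]_z \sum_(k < K) (2 ^+ (k * n.+1))%:E * (G k T (2^-1 ^+ J) z)%:E.
  rewrite ge0_integral_sum//.
  - apply: eq_bigr => k _; rewrite ge0_integralZl// ?lee_fin ?exprn_ge0//.
    by move=> z _; rewrite lee_fin.
  - by move=> k; exact: measurable_funeM.
  - by move=> k z _; rewrite mule_ge0// lee_fin// exprn_ge0.
apply: (@le_trans _ _ (\int[mu \x mu]_z ((2 * rho ^+ n.+1)%:E *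
   (\sum_(j < J) (level (2^-1 ^+ j.+1) z)%:E + (2 * T)%:E * (level 2^-1 z)%:E)))).
  apply: ge0_le_integral => //.
  - by move=> z _; apply: sume_ge0 => k _; rewrite mule_ge0// lee_fin// exprn_ge0.
  - by apply: emeasurable_sum => k; exact: measurable_funeM.
  - apply: measurable_funeM; apply: emeasurable_funD; last exact: measurable_funeM.
    by apply: emeasurable_sum => k.
  - move=> z _; under eq_bigr do rewrite -EFinM.
    by rewrite !sumEFin; have := sum_G_le K J z T1; rewrite -lee_fin.
have T20 : (0 <= 2 * T)%R by lra.
rewrite ge0_integralZl//; last 2 first.
- apply: emeasurable_funD; last exact: measurable_funeM.
  by apply: emeasurable_sum => k.
- move=> z _; rewrite adde_ge0//; last by rewrite mule_ge0// lee_fin.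
  by apply: sume_ge0 => k _; rewrite lee_fin.
rewrite ge0_integralD//; last 4 first.
- by move=> z _; apply: sume_ge0 => k _; rewrite lee_fin.
- by apply: emeasurable_sum => k.
- by move=> z _; rewrite mule_ge0// lee_fin.
- exact: measurable_funeM.
rewrite ge0_integralZl//; last by move=> z _; rewrite lee_fin.
rewrite ge0_integral_sum//; last by move=> k z _; rewrite lee_fin.
apply: (@le_trans _ _ ((2 * rho ^+ n.+1)%:E *
    (\sum_(j < J) M%:E + (2 * T)%:E * M%:E))).
  rewrite lee_wpmul2l ?lee_fin//; apply: leeD.
    apply: lee_sum => j _; apply: level_le.
    by rewrite exprn_gt0//= exprn_ilt1 ?invr_ge0 ?invf_lt1 ?ltr1n.
  rewrite lee_wpmul2l ?lee_fin//; apply: level_le.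
  by rewrite invr_gt0 ltr0n invf_lt1 ?ltr1n.
rewrite sumEFin sumr_const card_ord -[(M *+ J)%R]mulr_natl /J natrD.
rewrite -[leLHS]/((2 * rho ^+ n.+1 * ((s%:R + K%:R) * M + 2 * T * M))%:E).
by rewrite lee_fin le_eqVlt; apply/orP; left; apply/eqP; ring.
Qed.

Lemma integral_oscillation_le :
  \int[mu \x mu]_z (BB z * d z)%:E <= (2 * rho ^+ n.+1 * M)%:E.
Proof.
have I_le T s : (1 <= T)%R -> I 0 T (2^-1 ^+ s) <= (2 * rho ^+ n.+1 * M)%:E.
  move=> T1; have I0 : 0 <= I 0 T (2^-1 ^+ s).
    by apply: integral_ge0 => z _; rewrite lee_fin.
  have Ifin : I 0 T (2^-1 ^+ s) \is a fin_num.
    (* The case [K = 1] already shows finiteness, so the limit in [K] can be taken among real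
       numbers. *)
    rewrite ge0_fin_numE//; have := I_le_trunc s 1 T1.
    by rewrite mul1e => /le_lt_trans; apply; rewrite ltry.
  rewrite -(fineK Ifin) lee_fin; apply: (@le_of_natmul_le _ _ _ (s%:R + 2 * T)).
  by move=> K; rewrite -lee_fin EFinM fineK//; exact: I_le_trunc.
have T1 s : (1 <= s.+1%:R :> R)%R by rewrite ler1n.
have mG s : measurable_fun setT (fun z => (G 0 s.+1%:R (2^-1 ^+ s) z)%:E).
  by apply/measurable_EFinP; exact: measurable_G.
have G0 s z : [set: V * V] z -> 0 <= (G 0 s.+1%:R (2^-1 ^+ s) z)%:E.
  by move=> _; rewrite lee_fin.
have ndG z : [set: V * V] z ->
    nondecreasing_seq (fun s => (G 0 s.+1%:R (2^-1 ^+ s) z)%:E).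
  move=> _ s s' ss'; rewrite lee_fin ler_wpM2l ?mulr_ge0//.
  have e : (2^-1 ^+ s' <= 2^-1 ^+ s :> R)%R.
    by rewrite ler_wiXn2l ?invr_ge0 ?invf_le1 ?ler1n.
  apply: (le_trans (trunc_mono _ _ e)).
  rewrite /trunc ge_max !le_max lexx/=; apply/orP; right.
  by rewrite lerD2r le_min !ge_min lexx/= ler_nat ltnS ss' orbT.
have limG z : limn (fun s => (G 0 s.+1%:R (2^-1 ^+ s) z)%:E) = (BB z * d z)%:E.
  apply/cvg_lim => //; apply: cvg_EFin; first exact: nearW.
  (* By [B_diam] the scale 0 constraint holds for all pairs in [B]. *)
  have -> : (BB z * d z = BB z * near 0 z * d z)%R.
    rewrite /BB /near expr0 mulr1 !indicE.
    case: (boolP (z.1 \in B)) => [/set_mem Bx|]; last by rewrite !mul0r.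
    case: (boolP (z.2 \in B)) => [/set_mem By|]; last by rewrite mulr0 !mul0r.
    by rewrite B_diam//= ?mulr1n ?mulr1.
  by apply: cvgM; [exact: cvg_cst|apply: cvg_trunc; exact: normr_ge0].
have := monotone_convergence (mu \x mu) measurableT mG G0 ndG.
under eq_integral do rewrite limG.
move=> ->; apply: lime_le.
  apply: ereal_nondecreasing_is_cvgn => s s' ss'.
  apply: ge0_le_integral => //; first exact: G0.
  by move=> z zT; exact: ndG.
by apply: nearW => s; exact: I_le.
Qed.

End oscillation.

(** * Back to the Lebesgue sigma-algebra *)

(** The integral of a nonnegative function is a supremum over the simple functions below it, and a
    larger function has more of these. *)
Lemma ge0_le_integral_nonmeas {d} {T : measurableType d} {R : realType}
    (m : {measure set T -> \bar R}) (f g : T -> \bar R) :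
  (forall x, 0 <= f x)%E -> (forall x, f x <= g x)%E ->
  (\int[m]_x f x <= \int[m]_x g x)%E.
Proof.
move=> f0 fg; rewrite !ge0_integralTE//; last first.
  by move=> x; exact: le_trans (fg x).
by apply: le_ereal_sup => _ [h hf <-]; exists h => // x; exact: le_trans (fg x).
Qed.

Lemma product_null_cross {d} {T : measurableType d} {R : realType}
    (m : {sigma_finite_measure set T -> \bar R}) (N : set T) :
  measurable N -> m N = 0%E -> (m \x m)%E (N `*` setT `|` setT `*` N) = 0%E.
Proof.
move=> mN N0.
have NT : (m \x m)%E (N `*` setT) = 0%E.
  rewrite -(mul0e (m setT)) -N0; exact: product_measure1E.
have TN : (m \x m)%E (setT `*` N) = 0%E.
  rewrite -(mule0 (m setT)) -N0; exact: product_measure1E.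
by rewrite measureU0//; exact: measurableX.
Qed.

Section lebesgueRn_borel.
Local Open Scope ereal_scope.
Context {R : realType} {n : nat}.
Local Notation V := 'rV[R]_n.
Local Notation mu := (@borel_lebesgue R n).
Local Notation lam := (@lebesgueRn R n).

Lemma lebesgueRn_measurableE (A : set V) : measurable A -> lam A = mu A.
Proof. exact: measurable_mu_extE. Qed.

Lemma measurable_Rn_id : measurable_fun setT (id : Rn R n -> V).
Proof. exact: (@measurable_id_caratheodory _ _ _ mu). Qed.

Lemma measurable_Rn (A : set V) : measurable A -> measurable (A : set (Rn R n)).
Proof. exact: (@measurable_caratheodory _ _ _ mu). Qed.

Lemma measurable_Rn2_id :
  measurable_fun setT (id : Rn R n * Rn R n -> V * V).
Proof.
apply/measurable_fun_pairP; split.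
  exact: (measurableT_comp measurable_Rn_id measurable_fst).
exact: (measurableT_comp measurable_Rn_id measurable_snd).
Qed.

(** The identity from the completed to the Borel sigma-algebra is measurable and pushes [lam]
    forward to [mu]. *)
Lemma ge0_integral_lebesgueRn (f : V -> \bar R) : measurable_fun setT f ->
  (forall x, 0 <= f x) -> \int[lam]_x f x = \int[mu]_x f x.
Proof.
move=> mf f0.
have := ge0_integral_pushforward measurable_Rn_id lam measurableT mf.
rewrite preimage_setT => /(_ (fun x _ => f0 x)) pushE.
etransitivity; first exact: (esym pushE).
apply: eq_measure_integral; first exact: measurable_Rn_id.
by move=> mid A mA _; exact: lebesgueRn_measurableE.
Qed.

Lemma ge0_integral_lebesgueRn2 (g : V * V -> \bar R) : measurable_fun setT g ->
  (forall z, 0 <= g z) -> \int[lam \x lam]_z g z = \int[mu \x mu]_z g z.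
Proof.
move=> mg g0.
have mg' : measurable_fun setT (g : Rn R n * Rn R n -> \bar R).
  exact: (measurableT_comp mg measurable_Rn2_id).
rewrite (fubini_tonelli1 _ mg' g0) (fubini_tonelli1 _ mg g0).
rewrite -ge0_integral_lebesgueRn; last 2 first.
- exact: measurable_fun_fubini_tonelli_F.
- by move=> x; exact: integral_ge0.
apply: eq_integral => x _; apply: ge0_integral_lebesgueRn => // .
by apply: (measurableT_comp mg); apply: measurable_fun_pair.
Qed.

(** The exceptional pairs lie in the cross of [N] with the whole space, a null set of the
    product. *)
Lemma ge0_integral_prod_ae (m : measure_display) (T : measurableType m)
    (l : {sigma_finite_measure set T -> \bar R}) (N : set T)
    (f g : T * T -> \bar R) :
  measurable N -> l N = 0 -> measurable_fun setT f -> measurable_fun setT g ->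
  (forall z, 0 <= f z) -> (forall z, 0 <= g z) ->
  (forall x y, ~ N x -> ~ N y -> f (x, y) = g (x, y)) ->
  \int[l \x l]_z f z = \int[l \x l]_z g z.
Proof.
move=> mN N0 mf mg f0 g0 fg; apply: ge0_ae_eq_integral => //.
exists (N `*` setT `|` setT `*` N); split.
- by apply: measurableU; exact: measurableX.
- exact: product_null_cross.
- move=> [x y] /= /not_implyP[_ fgxy].
  have [Nx|Nx] := pselect (N x); first by left.
  have [Ny|Ny] := pselect (N y); first by right.
  by exfalso; apply: fgxy; exact: fg.
Qed.

Variables (p u : Rn R n -> R) (v : V -> R) (N B : set V).
Hypothesis mu_ : measurable_fun setT u.
Hypothesis mv : measurable_fun setT v.
Hypothesis mN : measurable N.
Hypothesis N0 : mu N = 0.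
Hypothesis uv : forall x, ~ N x -> u x = v x.
Hypothesis mB : measurable B.

Lemma level_le_truncated_energy (delta : R) : (0 <= delta)%R ->
  (forall x, B x -> p x = 1%R) ->
  \int[mu \x mu]_z (level v B delta z)%:E <= truncated_energy p u delta.
Proof.
move=> d0 pB.
have mlev : measurable_fun setT (fun z => (level v B delta z)%:E).
  by apply/measurable_EFinP; exact: measurable_level.
have lev0 z : 0 <= (level v B delta z)%:E by rewrite lee_fin level_ge0.
(* Cutting off the pairs that meet [N] changes no integral and makes the comparison with the energy
   of [u] hold at every point. *)
pose g z := (level v B delta z * (\1_(~` N) z.1 * \1_(~` N) z.2))%:E.
have mg : measurable_fun setT g.
  have mi := measurable_indic (R := R) (D := setT) (measurableC mN).
  apply/measurable_EFinP; apply: measurable_funM.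
    exact: measurable_level.
  apply: measurable_funM.
    exact: (measurableT_comp mi measurable_fst).
  exact: (measurableT_comp mi measurable_snd).
have g0 z : 0 <= g z by rewrite lee_fin mulr_ge0 ?level_ge0// mulr_ge0.
rewrite (ge0_integral_prod_ae mN N0 mlev mg lev0 g0); last first.
  by move=> x y Nx Ny; rewrite /g/= !indicE !mem_set// !mulr1.
rewrite -(ge0_integral_lebesgueRn2 mg g0) /truncated_energy [leRHS]integral_mkcond.
apply: ge0_le_integral_nonmeas => // -[x y].
have Df0 : 0 <= ((fun z : Rn R n * Rn R n =>
    (delta `^ p z.1 / edist z.1 z.2 `^ (n%:R + p z.1))%:E) \_
    [set z | (delta < `|u z.1 - u z.2|)%R]) (x, y).
  by apply: erestrict_ge0 => z _; rewrite lee_fin mulr_ge0 ?invr_ge0 ?powR_ge0.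
rewrite /g /level /=.
have [Nx|Nx] := pselect (N x).
  have -> : (\1_(~` N) x = 0 :> R)%R by rewrite indicE memNset//=; apply.
  by rewrite mul0r mulr0.
have [Ny|Ny] := pselect (N y).
  have -> : (\1_(~` N) y = 0 :> R)%R by rewrite indicE memNset//=; apply.
  by rewrite !mulr0.
have [Bx|Bx] := pselect (B x); last first.
  have -> : (\1_B x = 0 :> R)%R by rewrite indicE memNset.
  by rewrite !mul0r.
rewrite patchE.
have [uxy|uxy] := ltP delta (`|u x - u y|)%R; last first.
  by rewrite -!uv// ltNge uxy/= mul0r mulr0 mul0r.
rewrite mem_set//= lee_fin pB// -!uv// uxy mulr1n mul1r.
rewrite powRr1// natr1 powR_mulrn ?enorm_ge0//.
have : (0 <= delta / edist x y ^+ n.+1)%R.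
  by rewrite mulr_ge0// invr_ge0 exprn_ge0// enorm_ge0.
rewrite !indicE; set w := (delta / _)%R => w0.
by do 4 case: (_ \in _); rewrite ?(mulr1n, mulr0n, mulr0, mul0r, mulr1, mul1r) ?lexx.
Qed.

(** In the completed product [u] may be replaced by [v], and for the Borel function [v] the
    completion can then be dropped; Tonelli identifies the iterated integral. *)
Lemma double_oscillation_le :
  double_oscillation u B <=
  \int[mu \x mu]_z (\1_B z.1 * \1_B z.2 * `|v z.1 - v z.2|)%:E.
Proof.
have mBR : measurable (B : set (Rn R n)) by exact: measurable_Rn.
have mNR : measurable (N : set (Rn R n)) by exact: measurable_Rn.
pose h (T : Type) (w : T -> R) (A : set T) (z : T * T) :=
  (\1_A z.1 * \1_A z.2 * `|w z.1 - w z.2|)%:E.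
have mh d (T : measurableType d) (w : T -> R) (A : set T) :
    measurable_fun setT w -> measurable A -> measurable_fun setT (@h T w A).
  move=> mw mA; have mi := measurable_indic (R := R) (D := setT) mA.
  apply/measurable_EFinP; apply: measurable_funM.
    apply: measurable_funM.
      exact: (measurableT_comp mi measurable_fst).
    exact: (measurableT_comp mi measurable_snd).
  apply: measurableT_comp => //; apply: measurable_funB.
    exact: (measurableT_comp mw measurable_fst).
  exact: (measurableT_comp mw measurable_snd).
have h0 T (w : T -> R) A z : 0 <= @h T w A z by rewrite lee_fin !mulr_ge0.
have mvR : measurable_fun setT (v : Rn R n -> R).
  exact: (measurableT_comp mv measurable_Rn_id).
rewrite -(ge0_integral_lebesgueRn2 (mh _ _ v B mv mB) (h0 _ v B)).
rewrite -(ge0_integral_prod_ae mNR _ (mh _ _ u B mu_ mBR) (mh _ _ _ _ mvR mBR)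
  (h0 _ _ _) (h0 _ _ _)).
- rewrite (fubini_tonelli1 _ (mh _ _ u B mu_ mBR) (h0 _ _ _)).
  rewrite /double_oscillation [leLHS]integral_mkcond le_eqVlt; apply/orP; left; apply/eqP.
  apply: eq_integral => x _; rewrite patchE /fubini_F /h/=.
  case: ifPn => xB.
    rewrite integral_mkcond; apply: eq_integral => y _; rewrite patchE.
    rewrite [X in (X * _ * _)%R]indicE xB mul1r indicE.
    by case: ifPn => yB; rewrite ?mul1r ?mul0r.
  rewrite integral0_eq// => y _.
  by rewrite [X in (X * _ * _)%R]indicE (negbTE xB) !mul0r.
- exact: etrans (lebesgueRn_measurableE mN) N0.
- by move=> x y Nx Ny; rewrite /h/= !uv.
Qed.

(** The affine change of variables applied to the indicator of the ball, whose pullback is the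
    indicator of the unit ball. *)
Lemma lebesgueRn_ball (c : V) (r : R) : (0 < r)%R ->
  lam [set y | (edist c y < r)%R] =
  (r ^+ n)%:E * lam [set y | (edist (0 : V) y < 1)%R].
Proof.
move=> r0; rewrite !lebesgueRn_measurableE; try exact: measurable_eball.
have mI (A : set V) : measurable A -> measurable_fun setT (fun x => (\1_A x : R)%:E).
  by move=> mA; apply/measurable_EFinP; exact: measurable_indic.
have I0 (A : set V) x : 0 <= (\1_A x : R)%:E by rewrite lee_fin.
have := ge0_integral_borel_lebesgue_affine c r0 (mI _ (measurable_eball c r)) (I0 _).
have edistE x : edist c (c + r *: x)%R = (r * edist (0%R : V) x)%R.
  by rewrite /Defs.edist opprD addNKr sub0r -scalerN enormZ ?ltW.
have -> : \int[mu]_x (\1_[set y : V | (edist c y < r)%R] (c + r *: x)%R : R)%:E =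
    \int[mu]_x (\1_[set y : V | (edist (0 : V) y < 1)%R] x : R)%:E.
  apply: eq_integral => x _; rewrite !indicE.
  suff -> : ((c + r *: x)%R \in [set y : V | (edist c y < r)%R]) =
      (x \in [set y : V | (edist (0 : V) y < 1)%R]) by [].
  by apply/idP/idP => /set_mem /= h; apply/mem_set => /=; move: h;
    rewrite edistE -{2}(mulr1 r) ltr_pM2l.
rewrite !integral_indic ?setIT//; try exact: measurable_eball.
move=> ->; rewrite muleA -EFinM -exprMn divff ?expr1n ?mul1e//.
by rewrite gt_eqF.
Qed.

End lebesgueRn_borel.

(** A positive factor preserves both infinities, and [fine] sends them to 0 on either side. *)
Lemma fine_pmul {R : realType} (a : R) (x : \bar R) : 0 < a ->
  fine (a%:E * x) = a * fine x.
Proof.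
move=> a0; case: x => [x| |]//=; first by rewrite /mule/= gt_eqF// lte_fin a0 /= mulr0.
by rewrite /mule/= gt_eqF// lte_fin a0 /= mulr0.
Qed.

(** * Uniformity over balls, by scaling *)

Theorem mainTheorem2 (R : realType) (n : nat) (p u : Rn R n -> R)
    (E : set 'rV[R]_n) :
  (0 < n)%N ->
  measurable_fun setT p ->
  (forall x, 1 <= p x) ->
  ess_infr lebesgueRn p = 1%:E ->
  (ess_infr lebesgueRn p <= ess_supr lebesgueRn p)%E ->
  (ess_supr lebesgueRn p < +oo)%E ->
  variable_Lp p u ->
  E = [set x | p x = 1] ->
  interior E !=set0 ->
  (ereal_sup [set truncated_energy p u delta | delta in `]0%R, 1%R[] < +oo)%E ->
  (ereal_sup [set (fine (lebesgueRn B) `^ (- (n.+1%:R / n%:R)))%R%:E *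
                  double_oscillation u B
             | B in ball_inside (interior E)] < +oo)%E /\
  (n = 1%N -> BMO E u).
Proof.
move=> n0 _ _ _ _ _ [mu_ _] EE _ energy_fin.
set e := ereal_sup _ in energy_fin.
have n_gt0 : 0 < n%:R :> R by rewrite ltr0n.
have [N [mN N0 mv]] := caratheodory_measurable_fun mu_.
set v := (fun x : 'rV[R]_n => _) in mv.
have uv x : ~ N x -> u x = v x.
  by move=> Nx; rewrite /v indicE mem_set// mulr1.
have half : 0 < (2^-1 : R) < 1 by rewrite invr_gt0 ltr0n invf_lt1 ?ltr1n.
have energy_le delta : 0 < delta < 1 -> (truncated_energy p u delta <= e)%E.
  by move=> d01; apply: ereal_sup_ubound; exists delta => //=; rewrite in_itv.
have e0 : (0 <= e)%E.
  apply: le_trans (energy_le _ half); apply: integral_ge0 => z _.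
  by rewrite lee_fin mulr_ge0 ?invr_ge0 ?powR_ge0.
pose M := fine e.
have eM : e = M%:E by rewrite fineK// ge0_fin_numE.
have M0 : 0 <= M by exact: fine_ge0.
pose w := fine (lebesgueRn [set y : 'rV[R]_n | edist 0 y < 1]).
pose a : R := - (n.+1%:R / n%:R).
have a0 : a != 0 by rewrite oppr_eq0 mulf_neq0 ?invr_eq0 ?pnatr_eq0// -lt0n.
(* The bound is independent of the ball: the volume power contributes [r^-(n+1)], which cancels the
   radius in [(2 * r) ^+ n.+1], where [rho = 2 * r]. *)
have osc_le B : ball_inside (interior E) B ->
    ((fine (lebesgueRn B) `^ a)%:E * double_oscillation u B <=
     (w `^ a * (2 * 2 ^+ n.+1 * M))%:E)%E.
  move=> [[c [r [r0 ->]]] BE].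
  rewrite lebesgueRn_ball// fine_pmul ?exprn_gt0// -/w.
  have mB := measurable_eball c r.
  have pB x : edist c x < r -> p x = 1.
    by move=> /BE /interior_subset; rewrite EE.
  have oscE := double_oscillation_le mu_ mv mN N0 uv mB.
  have : (double_oscillation u [set y | (edist c y < r)%R] <=
      (2 * (2 * r) ^+ n.+1 * M)%:E)%E.
    apply: (le_trans oscE); apply: integral_oscillation_le => //.
    - by rewrite mulr_gt0.
    - move=> x y /= xc yc; rewrite edistC; apply: edist_midpoint_ball => //.
        by rewrite edistC.
      by rewrite edistC.
    - move=> x y /= xc yc; apply: (@edist_ball_lt _ _ c) => //.
        by rewrite edistC.
      by rewrite edistC.
    - move=> delta d01; rewrite -eM; apply: le_trans (energy_le _ d01).
      apply: (@level_le_truncated_energy _ _ _ _ _ N) => //.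
      by case/andP: d01 => /ltW.
  move=> osc; apply: (@le_trans _ _ (((r ^+ n * w) `^ a)%:E *
      (2 * (2 * r) ^+ n.+1 * M)%:E)%E).
    by rewrite lee_wpmul2l// lee_fin powR_ge0.
  rewrite -EFinM lee_fin powRM ?exprn_ge0 ?(ltW r0) ?fine_ge0//.
  (* The exponents multiply to [n * a = - (n + 1)]. *)
  have -> : (r ^+ n) `^ a = (r ^+ n.+1)^-1.
    rewrite -powR_mulrn ?(ltW r0)// -powRrM /a mulrN mulrCA divff ?gt_eqF// mulr1.
    by rewrite powRN powR_mulrn// ltW.
  rewrite le_eqVlt; apply/orP; left; apply/eqP; rewrite exprMn; field.
  by rewrite expf_neq0// gt_eqF.
have sup_le : (ereal_sup [set (fine (lebesgueRn B) `^ a)%:E * double_oscillation u B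
    | B in ball_inside (interior E)] < +oo)%E.
  apply: (@le_lt_trans _ _ (w `^ a * (2 * 2 ^+ n.+1 * M))%:E); last exact: ltry.
  by apply: ge_ereal_sup => _ [B EB <-]; exact: osc_le.
split => // n1; rewrite /BMO.
have aE : a = - 2%:R by rewrite /a n1 divr1.
rewrite (_ : [set _ | B in _] = [set ((fine (lebesgueRn B) `^ a)%:E *
  double_oscillation u B)%E | B in ball_inside (interior E)])//.
apply/seteqP; split => _ [B EB <-]; exists B => //; congr (_%:E * _)%E.
  by rewrite aE powRN powR_mulrn// fine_ge0.
by rewrite aE powRN powR_mulrn// fine_ge0.
Qed.
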